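(* Let $Z_1,Z_2,\dots,Z_n$ be i.i.d. with distribution $F_Z$. Let $k=k_n\le n$ and $B=B_n\ge1$ be integers depending on $n$, with $k_n$ increasing in $n$ and $k_n\to\infty$. Let $\tilde\theta_n=\big[\sum_{i=1}^n g(Z_i)\big]^{-1}\big[\sum_{i=1}^n f(Z_i)\big]$, and let $\hat\theta_V$ be the resampled $V$-statistic estimator with kernel $h_k$ based on $B$ size-$k$ samples drawn with replacement from $\{Z_1,\dots,Z_n\}$. Assume $h_k\in\mathcal H$, $k=o(n^{1/4})$, $\lim_{n\to\infty}k^2\zeta_{1,k}>0$ (the limit exists and is a positive definite matrix), and $\lim_{n\to\infty}\frac{n}{Bk}=0$. Then $$\liminf_{n\to\infty}\big[\mathrm{Var}(\tilde\theta_n)-\mathrm{Var}(\hat\theta_V)\big]\ \ge\ 0,$$ where this inequality between covariance matrices means $\liminf_{n\to\infty} v^\top\big[\mathrm{Var}(\tilde\theta_n)-\mathrm{Var}(\hat\theta_V)\big]v\ge 0$ for every $v\in\mathbb{R}^q$.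
   Context: $F_Z$ is a probability distribution on a space $\mathcal Z$ and $Z\sim F_Z$. Fix functions $g:\mathcal Z\to\mathbb R^{q\times q}$, with values in the invertible matrices, and $f:\mathcal Z\to\mathbb R^q$. All inverses appearing (of $\mathbb E[g(Z)]$ and of the sums of values of $g$ defining the estimators, including sums with repeated data points) are assumed to exist (almost surely, for random matrices), and all variances and covariances appearing are assumed finite. The target is $\theta=[\mathbb E[g(Z)]]^{-1}\mathbb E[f(Z)]\in\mathbb R^q$. Kernel: for $k$ data points $z_1,\dots,z_k\in\mathcal Z$, $h_k(z_1,\dots,z_k)=\big[\sum_{i=1}^k g(z_i)\big]^{-1}\big[\sum_{i=1}^k f(z_i)\big]\in\mathbb R^q$. Resampled (incomplete, infinite-order) $V$-statistic: given $Z_1,\dots,Z_n$, draw $B$ index tuples $(i_1,\dots,i_k)$, $i=1,\dots,B$, independently and uniformly at random from $\{1,\dots,n\}^k$ (repetitions of indices allowed), independently of the data, and set $\hat\theta_V=V_{n,k,B}=\frac1B\sum_{i=1}^B h_k(Z_{i_1},\dots,Z_{i_k})$. Here $\mathrm{Var}(\hat\theta_V)$ is taken over both the data and the random resampling. For an $\mathbb R^q$-valued random vector, $\mathrm{Var}$ denotes its $q\times q$ covariance matrix. Variance components: for $1\le c\le k$, $\zeta_{c,k}=\mathrm{Cov}\big(h_k(Z_1,\dots,Z_k),\,h_k(Z_1,\dots,Z_c,Z'_{c+1},\dots,Z'_k)\big)$, a $q\times q$ matrix, where $Z'_{c+1},\dots,Z'_k$ are i.i.d. from $F_Z$ and independent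 of $Z_1,\dots,Z_n$. Class $\mathcal H$: $\mathcal H=\big\{h_k:\ \sup_k\big\|\mathbb E[h_k(Z_{i_1},\dots,Z_{i_k})h_k(Z_{i_1},\dots,Z_{i_k})^\top]\big\|_\infty<\infty\big\}$, where $(i_1,\dots,i_k)$ are indices selected with replacement from $\{1,\dots,k\}$, i.e. the bound holds uniformly in $k$ and over all tuples $(i_1,\dots,i_k)\in\{1,\dots,k\}^k$, repetitions allowed. *)

(* Defs.v *)
From HB Require Import structures.
From mathcomp Require Export all_boot all_order all_algebra.
From mathcomp Require Export all_classical all_reals all_analysis.
Export numFieldNormedType.Exports.
Export Order.TTheory GRing.Theory Num.Theory.

Set Implicit Arguments.
Unset Strict Implicit.
Unset Printing Implicit Defensive.

Local Open Scope classical_set_scope.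
Local Open Scope ring_scope.

(* [S i] is a system of events, typically the sigma-algebra generated by the
   i-th random variable; the variables may take values in different types. *)
Definition mutually_independent (d : measure_display) (Omega : measurableType d)
    (R : realType) (P : probability Omega R) (I : choiceType)
    (S : I -> set (set Omega)) : Prop :=
  forall (s : seq I) (E : I -> set Omega), uniq s ->
    (forall i, i \in s -> S i (E i)) ->
    P (\bigcap_(i in [set` s]) E i) = (\prod_(i <- s) P (E i))%E.

Definition generated_events (Omega U : Type) (G : set (set U))
    (X : Omega -> U) : set (set Omega) :=
  preimage_set_system setT X G.

Definition has_law (d d' : measure_display) (Omega : measurableType d)
    (T : measurableType d') (R : realType) (P : probability Omega R)
    (F : probability T R) (X : {RV P >-> T}) : Prop :=
  forall A : set T, measurable A -> distribution P X A = F A.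

(* The two families [Z] and [Z'] together form one i.i.d. sample from [F]. *)
Definition iid_pair (d d' : measure_display) (Omega : measurableType d)
    (T : measurableType d') (R : realType) (P : probability Omega R)
    (F : probability T R) (Z Z' : nat -> {RV P >-> T}) : Prop :=
  [/\ forall i, has_law F (Z i),
      forall i, has_law F (Z' i) &
      mutually_independent P (fun i : nat + nat =>
        match i with
        | inl a => generated_events measurable (Z a)
        | inr a => generated_events measurable (Z' a)
        end)].

(* [J b w j] is the j-th entry of the b-th index tuple, drawn with replacement.
   Only the data points [Z 0], ..., [Z n.-1] take part in the independence. *)
Definition uniform_resampling (d d' : measure_display)
    (Omega : measurableType d) (T : measurableType d') (R : realType)
    (P : probability Omega R) (Z : nat -> {RV P >-> T}) (n k B : nat)
    (J : 'I_B -> Omega -> {ffun 'I_k -> 'I_n}) : Prop :=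
  [/\ forall b t, measurable (J b @^-1` [set t]),
      forall b t, P (J b @^-1` [set t]) = ((n ^ k)%N%:R^-1 : R)%:E &
      mutually_independent P (fun i : 'I_n + 'I_B =>
        match i with
        | inl a => generated_events measurable (Z a)
        | inr b => generated_events setT (J b)
        end)].

(* [fine] sends infinite or
   undefined values to 0, so [mean_mx] is only meaningful under
   [integrable_mx], and [cov_mx] under [square_integrable] of both arguments. *)
Definition integrable_mx (d : measure_display) (Omega : measurableType d)
    (R : realType) (P : probability Omega R) (m n : nat)
    (X : Omega -> 'M[R]_(m, n)) : Prop :=
  forall i j, (fun w => X w i j) \in Lfun P 1%E.

Definition mean_mx (d : measure_display) (Omega : measurableType d)
    (R : realType) (P : probability Omega R) (m n : nat)
    (X : Omega -> 'M[R]_(m, n)) : 'M[R]_(m, n) :=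
  \matrix_(i < m, j < n) fine ('E_P[fun w => X w i j])%E.

Definition square_integrable (d : measure_display) (Omega : measurableType d)
    (R : realType) (P : probability Omega R) (q : nat)
    (X : Omega -> 'cV[R]_q) : Prop :=
  forall i, (fun w => X w i ord0) \in Lfun P 2%:E.

Definition cov_mx (d : measure_display) (Omega : measurableType d)
    (R : realType) (P : probability Omega R) (q : nat)
    (X Y : Omega -> 'cV[R]_q) : 'M[R]_q :=
  \matrix_(i < q, j < q)
    fine (covariance P (fun w => X w i ord0) (fun w => Y w j ord0)).

Definition var_mx (d : measure_display) (Omega : measurableType d)
    (R : realType) (P : probability Omega R) (q : nat)
    (X : Omega -> 'cV[R]_q) : 'M[R]_q :=
  cov_mx P X X.

Definition quad_form (R : realType) (q : nat) (A : 'M[R]_q) (v : 'cV[R]_q) : R :=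
  (v^T *m A *m v) ord0 ord0.

Definition positive_definite (R : realType) (q : nat) (A : 'M[R]_q) : Prop :=
  A^T = A /\ forall v : 'cV[R]_q, v != 0 -> 0 < quad_form A v.

Definition sum_g (R : realType) (T : Type) (q : nat) (g : T -> 'M[R]_q)
    (k : nat) (z : 'I_k -> T) : 'M[R]_q :=
  \sum_(i < k) g (z i).

Definition kernel_h (R : realType) (T : Type) (q : nat) (g : T -> 'M[R]_q)
    (f : T -> 'cV[R]_q) (k : nat) (z : 'I_k -> T) : 'cV[R]_q :=
  invmx (sum_g g z) *m \sum_(i < k) f (z i).

Definition theta_tilde (R : realType) (T Omega : Type) (q : nat)
    (g : T -> 'M[R]_q) (f : T -> 'cV[R]_q) (Z : nat -> Omega -> T) (n : nat)
    (w : Omega) : 'cV[R]_q :=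
  invmx (\sum_(i < n) g (Z i w)) *m \sum_(i < n) f (Z i w).

Definition V_stat (R : realType) (T Omega : Type) (q : nat)
    (h : forall k : nat, ('I_k -> T) -> 'cV[R]_q) (Z : nat -> Omega -> T)
    (n k B : nat) (J : 'I_B -> Omega -> {ffun 'I_k -> 'I_n}) (w : Omega) :
    'cV[R]_q :=
  B%:R^-1 *: \sum_(b < B) h k (fun j => Z (J b w j) w).

(* The data point with (0-based) position [i] is shared with [Z] iff [i < c]. *)
Definition shared_sample (T Omega : Type) (Z Z' : nat -> Omega -> T) (c k : nat)
    (w : Omega) (i : 'I_k) : T :=
  if (i < c)%N then Z i w else Z' i w.

Definition zeta (d : measure_display) (Omega : measurableType d)
    (R : realType) (P : probability Omega R) (T : Type) (q : nat)
    (h : forall k : nat, ('I_k -> T) -> 'cV[R]_q) (Z Z' : nat -> Omega -> T)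
    (c k : nat) : 'M[R]_q :=
  cov_mx P (fun w => h k (fun i => Z i w))
           (fun w => h k (shared_sample Z Z' c w)).

(* The norm is the largest absolute value of an entry. *)
Definition class_H (d : measure_display) (Omega : measurableType d)
    (R : realType) (P : probability Omega R) (T : Type) (q : nat)
    (Z : nat -> Omega -> T)
    (h : forall k : nat, ('I_k -> T) -> 'cV[R]_q) : Prop :=
  exists M : R, forall (k : nat) (t : 'I_k -> 'I_k), (0 < k)%N ->
    let H := fun w => h k (fun j => Z (t j) w) in
    integrable_mx P (fun w => H w *m (H w)^T) /\
    `| mean_mx P (fun w => H w *m (H w)^T) | <= M.

(* Main.v *)
From HB Require Import structures.
From mathcomp Require Import measurable_realfun ring lra.
Require Import Defs.

(* Var(tilde theta_n) is nonnegative as a quadratic form, so it suffices that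
   Var(hat theta_V) tends to 0. The index tuples being independent of the data,
   the pairs b != b' contribute n^(-2k) sum_(s, t) Cov(x_s, x_t) to the variance
   of v^T hat theta_V, where x_s = v^T h_k(Z_(s 1), ..., Z_(s k)), and the
   diagonal b = b' contributes O(1/B). Tuples s and t without a common
   index give independent x_s and x_t, hence no covariance; at most a fraction
   k^2/n of the pairs meet, and relabelling indices bounds each such covariance
   through the class H. The resulting bound C/B + 2 C k^2/n tends to 0, since
   1/B <= n/(Bk) and k = o(n^(1/4)). *)

Set Implicit Arguments.
Unset Strict Implicit.
Unset Printing Implicit Defensive.

Local Open Scope classical_set_scope.
Local Open Scope ring_scope.

(** * Laws of finite tuples and independence of blocks *)

(** Measurable rectangles are stable under intersection, contain the whole space and generate the
    sigma-algebra of tuples, so they determine a finite measure. *)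
Lemma tuple_measure_unique (R : realType) (d : measure_display)
    (T : measurableType d) (n : nat)
    (m1 m2 : {measure set (n.-tuple T) -> \bar R}) :
  (m1 setT < +oo)%E ->
  (forall A : 'I_n -> set T, (forall i, measurable (A i)) ->
     m1 (\bigcap_i (@tnth n T ^~ i @^-1` A i)) =
     m2 (\bigcap_i (@tnth n T ^~ i @^-1` A i))) ->
  forall A, measurable A -> m1 A = m2 A.
Proof.
move=> m1oo m12.
pose G : set (set (n.-tuple T)) := [set C | exists2 A : 'I_n -> set T,
  forall i, measurable (A i) & C = \bigcap_i (@tnth n T ^~ i @^-1` A i)].
have mrect C : G C -> measurable C.
  move=> [A mA ->]; apply: fin_bigcap_measurable => // i _.
  by rewrite -[X in measurable X]setTI; apply: measurable_tnth.
apply: (measure_unique G (fun=> setT)).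
- apply/seteqP; split; last first.
    exact: smallest_sub (@sigma_algebra_measurable _ (n.-tuple T)) mrect.
  apply: smallest_sub; first exact: smallest_sigma_algebra.
  move=> C; rewrite -bigcup_seq => -[i /= _ [B mB <-{C}]].
  apply: sub_sigma_algebra.
  (* The sigma-algebra of tuples is generated by preimages under single coordinates; such a preimage
     is a rectangle whose other sides are full. *)
  exists (fun j => if j == i then B else setT).
    by move=> j; case: ifP.
  rewrite setTI; apply/seteqP; split=> [x Bx j _ /=|x /(_ i I)/=].
    by case: eqP => // ->.
  by rewrite eqxx.
- move=> _ _ [A mA ->] [B mB ->]; exists (fun i => A i `&` B i).
    by move=> i; exact: measurableI.
  apply/seteqP; split=> [x [Ax Bx] i _|x ABx].
    by split; [exact: Ax|exact: Bx].
  by split=> i _; have [] := ABx i I.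
- move=> _; exists (fun=> setT) => //.
  by apply/seteqP; split.
- by apply/seteqP; split=> // x _; exists 0%N.
- by move=> _ [A mA ->]; exact: m12.
- by [].
Qed.

Definition joint (d d' : measure_display) (Omega : measurableType d)
    (T : measurableType d') (n : nat) (X : 'I_n -> {mfun Omega >-> T})
    (w : Omega) : n.-tuple T :=
  [tuple X i w | i < n].

Lemma measurable_joint (d d' : measure_display) (Omega : measurableType d)
    (T : measurableType d') (n : nat) (X : 'I_n -> {mfun Omega >-> T}) :
  measurable_fun setT (joint X).
Proof.
apply/measurable_fun_tnthP => i.
rewrite [X in measurable_fun _ X](_ : _ = X i :> (Omega -> T))//.
by apply/funext => w /=; rewrite tnth_mktuple.
Qed.

HB.instance Definition _ (d d' : measure_display) (Omega : measurableType d)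
    (T : measurableType d') (n : nat) (X : 'I_n -> {mfun Omega >-> T}) :=
  isMeasurableFun.Build _ _ _ _ (joint X) (measurable_joint X).

Lemma joint_rect (d d' : measure_display) (Omega : measurableType d)
    (T : measurableType d') (n : nat) (X : 'I_n -> {mfun Omega >-> T})
    (A : 'I_n -> set T) :
  joint X @^-1` (\bigcap_i (@tnth n T ^~ i @^-1` A i)) =
  \bigcap_i (X i @^-1` A i).
Proof.
by apply/seteqP; split=> w Aw i _; have := Aw i I; rewrite /= tnth_mktuple.
Qed.

(** Passes from duplicate-free sequences of indices to a family indexed by a finite type:
    injectivity of [sigma] makes the image of the enumeration duplicate-free. *)
Lemma mutually_independent_inj (d : measure_display) (Omega : measurableType d)
    (R : realType) (P : probability Omega R) (U : choiceType)
    (S : U -> set (set Omega)) (K : finType) (sigma : K -> U)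
    (E : K -> set Omega) :
  mutually_independent P S -> injective sigma ->
  (forall i, S (sigma i) (E i)) ->
  P (\bigcap_i E i) = (\prod_i P (E i))%E.
Proof.
move=> indep sigma_inj SE.
(* The definition of independence wants an event at every index; off the range of [sigma] the value
   [setT] is a filler. *)
pose E' j := if [pick i | sigma i == j] is Some i then E i else setT.
have E'sigma i : E' (sigma i) = E i.
  rewrite /E'; case: pickP => [i' /eqP/sigma_inj->//|/(_ i)].
  by rewrite eqxx.
have := indep (map sigma (enum K)) E'.
rewrite map_inj_uniq// enum_uniq => /(_ isT).
rewrite big_map big_enum /= (eq_bigr (fun i => P (E i))); last first.
  by move=> i _; rewrite E'sigma.
move=> <-; last by move=> _ /mapP[i _ ->]; rewrite E'sigma.
congr (P _); apply/seteqP; split=> [w Ew _ /= /mapP[i _ ->]|w Ew i _].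
  by rewrite E'sigma; exact: Ew.
by rewrite -E'sigma; apply: Ew => /=; rewrite map_f ?mem_enum.
Qed.

(** The two blocks glue to one injective family over [K + L], and the product over the sum type
    splits in two. *)
Lemma mutually_independent_blocks (d : measure_display)
    (Omega : measurableType d) (R : realType) (P : probability Omega R)
    (U : choiceType) (S : U -> set (set Omega)) (K L : finType)
    (sigma : K -> U) (tau : L -> U) (E : K -> set Omega) (E' : L -> set Omega) :
  mutually_independent P S -> injective sigma -> injective tau ->
  (forall i j, sigma i != tau j) ->
  (forall i, S (sigma i) (E i)) -> (forall j, S (tau j) (E' j)) ->
  P ((\bigcap_i E i) `&` (\bigcap_j E' j)) =
  (P (\bigcap_i E i) * P (\bigcap_j E' j))%E.
Proof.
move=> indep sigma_inj tau_inj sigma_tau SE SE'.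
rewrite (mutually_independent_inj indep sigma_inj SE).
rewrite (mutually_independent_inj indep tau_inj SE').
pose rho (x : K + L) := match x with inl i => sigma i | inr j => tau j end.
pose E'' (x : K + L) := match x with inl i => E i | inr j => E' j end.
have rho_inj : injective rho.
  move=> [i|j] [i'|j'] /=.
  - by move/sigma_inj ->.
  - by move/eqP; rewrite (negbTE (sigma_tau _ _)).
  - by move/esym/eqP; rewrite (negbTE (sigma_tau _ _)).
  - by move/tau_inj ->.
have SE'' x : S (rho x) (E'' x) by case: x.
have := mutually_independent_inj indep rho_inj SE''.
rewrite big_sumType /= => <-; congr (P _).
apply/seteqP; split=> [w [Ew E'w] [i|j] _|w Ew].
- exact: Ew.
- exact: E'w.
- split=> [i _|j _]; first exact: (Ew (inl i) I).
  exact: (Ew (inr j) I).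
Qed.

(** Both sides are finite measures in [A]: the law of the tuple under [P] restricted to [E], and its
    law under [P] scaled by [P E]. It therefore suffices to compare them on rectangles. *)
Lemma joint_independent (d d' : measure_display) (Omega : measurableType d)
    (T : measurableType d') (R : realType) (P : probability Omega R) (n : nat)
    (X : 'I_n -> {mfun Omega >-> T}) (E : set Omega) : measurable E ->
  (forall A : 'I_n -> set T, (forall i, measurable (A i)) ->
     P ((\bigcap_i (X i @^-1` A i)) `&` E) =
     (P (\bigcap_i (X i @^-1` A i)) * P E)%E) ->
  forall A, measurable A ->
    P (joint X @^-1` A `&` E) = (P (joint X @^-1` A) * P E)%E.
Proof.
move=> mE indep A mA.
have PEfin : P E \is a fin_num by exact: fin_num_measure.
have PE0 : 0 <= fine (P E) by exact: fine_ge0.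
pose m1 := pushforward (mrestr P mE) (joint X).
pose m2 := mscale (NngNum PE0) (distribution P (joint X)).
have -> : P (joint X @^-1` A `&` E) = m1 A by [].
have -> : (P (joint X @^-1` A) * P E)%E = m2 A.
  by rewrite /m2 /mscale /= fineK// muleC.
apply: tuple_measure_unique => //.
  rewrite /= /pushforward /mrestr /= preimage_setT setTI.
  by rewrite (le_lt_trans (probability_le1 _ _))// ltry.
move=> B mB; rewrite /= /pushforward /mrestr /mscale /= fineK//.
by rewrite muleC /distribution /pushforward joint_rect indep.
Qed.

(** On a rectangle both laws are the product of the values of [F] on the sides, whichever distinct
    indices are chosen. *)
Lemma joint_same_law (d d' : measure_display) (Omega : measurableType d)
    (T : measurableType d') (R : realType) (P : probability Omega R)
    (F : probability T R) (U : choiceType) (X : U -> {RV P >-> T})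
    (n : nat) (sigma tau : 'I_n -> U) :
  (forall i, has_law F (X i)) ->
  mutually_independent P (fun i => generated_events measurable (X i)) ->
  injective sigma -> injective tau ->
  forall A, measurable A ->
    distribution P (joint (X \o sigma)) A = distribution P (joint (X \o tau)) A.
Proof.
move=> lawX indep sigma_inj tau_inj; apply: tuple_measure_unique => //.
  by rewrite (le_lt_trans (probability_le1 _ _))// ltry.
move=> A mA; rewrite /= /distribution /pushforward !joint_rect.
have gen rho : forall i : 'I_n, generated_events measurable (X (rho i))
    (X (rho i) @^-1` A i).
  by move=> i; exists (A i) => //; rewrite setTI.
rewrite (mutually_independent_inj indep sigma_inj (gen sigma)).
rewrite (mutually_independent_inj indep tau_inj (gen tau)).
apply: eq_bigr => i _.
by have := lawX (sigma i) _ (mA i); have := lawX (tau i) _ (mA i);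
  rewrite /distribution /pushforward => -> ->.
Qed.

(** * Real-valued means of integrable and square-integrable functions *)

Definition mean (d : measure_display) (Omega : measurableType d)
    (R : realType) (P : probability Omega R) (X : Omega -> R) : R :=
  fine ('E_P[X])%E.

Section mean.
Context (d : measure_display) (Omega : measurableType d) (R : realType).
Context (P : probability Omega R).
Implicit Types (X Y : Omega -> R).

Lemma Lfun_measurable (p : \bar R) X : X \in Lfun P p -> measurable_fun setT X.
Proof. by rewrite inE => /andP[]; rewrite inE. Qed.

Lemma Lfun1_Lfun2 X : X \in Lfun P 2%:E -> X \in Lfun P 1.
Proof. by apply: Lfun_subset12; rewrite fin_num_measure. Qed.

Lemma Lfun1M X Y : X \in Lfun P 2%:E -> Y \in Lfun P 2%:E ->
  (fun w => X w * Y w) \in Lfun P 1.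
Proof. exact: Lfun2_mul_Lfun1. Qed.

Lemma sqr_Lfun1_Lfun2 X : measurable_fun setT X ->
  (fun w => X w * X w) \in Lfun P 1 -> X \in Lfun P 2%:E.
Proof.
move=> mX /Lfun1_integrable/integrableP[_ X2oo].
rewrite inE; apply/andP; split; rewrite inE//= /finite_norm unlock /Lnorm.
rewrite poweR_lty//; apply: le_lt_trans X2oo.
rewrite le_eqVlt; apply/orP; left; apply/eqP; apply: eq_integral => w _ /=.
by rewrite powR_mulrn// normrM expr2.
Qed.

Lemma Lfun1_le X Y : measurable_fun setT X -> Y \in Lfun P 1 ->
  (forall w, `|X w| <= `|Y w|) -> X \in Lfun P 1.
Proof.
move=> mX /Lfun1_integrable iY XY; apply/Lfun1_integrable.
apply: le_integrable iY => //; first exact/measurable_EFinP.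
by move=> w _ /=; rewrite lee_fin.
Qed.

Lemma Lfun_indicM (E : set Omega) X : measurable E ->
  X \in Lfun P 1 -> (fun w => \1_E w * X w) \in Lfun P 1.
Proof.
move=> mE X1; apply: (Lfun1_le _ X1).
  by apply: measurable_funM; [exact: measurable_indic|exact: Lfun_measurable X1].
move=> w; rewrite normrM indicE; case: (w \in E).
  by rewrite normr1 mul1r.
by rewrite normr0 mul0r.
Qed.

Lemma Lfun2_indicM (E : set Omega) X : measurable E ->
  X \in Lfun P 2%:E -> (fun w => \1_E w * X w) \in Lfun P 2%:E.
Proof.
move=> mE X2; apply: sqr_Lfun1_Lfun2.
  by apply: measurable_funM; [exact: measurable_indic|exact: Lfun_measurable X2].
rewrite (_ : (fun _ => _) = (fun w => \1_E w * (X w * X w))).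
  by apply: Lfun_indicM => //; exact: Lfun1M.
apply/funext => w; rewrite indicE; case: (w \in E); rewrite ?mul1r//.
by rewrite !mul0r.
Qed.

Lemma mean_ge0 X : (forall w, 0 <= X w) -> 0 <= mean P X.
Proof. by move=> X0; rewrite fine_ge0// expectation_ge0. Qed.

Lemma mean_indic (E : set Omega) : measurable E -> mean P \1_E = fine (P E).
Proof. by move=> mE; rewrite /mean expectation_indic. Qed.

Lemma meanD X Y : X \in Lfun P 1 -> Y \in Lfun P 1 ->
  mean P (fun w => X w + Y w) = mean P X + mean P Y.
Proof.
move=> X1 Y1; rewrite /mean (_ : (fun w => _) = X \+ Y)//.
by rewrite expectationD// fineD// expectation_fin_num.
Qed.

Lemma Lfun1Z (c : R) X : X \in Lfun P 1 -> (fun w => c * X w) \in Lfun P 1.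
Proof.
move=> X1; rewrite (_ : (fun w => _) = c \o* X); last first.
  by apply/funext => w; rewrite /= mulrC.
exact: Lfun_scale.
Qed.

Lemma Lfun1D X Y : X \in Lfun P 1 -> Y \in Lfun P 1 ->
  (fun w => X w + Y w) \in Lfun P 1.
Proof. by move=> X1 Y1; apply: rpredD. Qed.

Lemma meanZ (c : R) X : X \in Lfun P 1 ->
  mean P (fun w => c * X w) = c * mean P X.
Proof.
move=> X1; rewrite /mean (_ : (fun w => _) = c \o* X); last first.
  by apply/funext => w; rewrite /= mulrC.
by rewrite expectationZl// fineM// expectation_fin_num.
Qed.

Lemma Lfun_sum (I : finType) (X : I -> Omega -> R) :
  (forall i, X i \in Lfun P 1) ->
  (fun w => \sum_i X i w) \in Lfun P 1.
Proof.
move=> X1; rewrite (_ : (fun w => _) = \sum_i X i); first exact: rpred_sum.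
by apply/funext => w; rewrite fct_sumE.
Qed.

Lemma Lfun2_sum (I : finType) (X : I -> Omega -> R) :
  (forall i, X i \in Lfun P 2%:E) ->
  (fun w => \sum_i X i w) \in Lfun P 2%:E.
Proof.
move=> X1; rewrite (_ : (fun w => _) = \sum_i X i); last first.
  by apply/funext => w; rewrite fct_sumE.
by apply: rpred_sum => //; rewrite lee1n.
Qed.

Lemma mean_sum (I : finType) (X : I -> Omega -> R) :
  (forall i, X i \in Lfun P 1) ->
  mean P (fun w => \sum_i X i w) = \sum_i mean P (X i).
Proof.
move=> X1; rewrite -[LHS](_ : mean P (\sum_i X i) = _); last first.
  by congr mean; apply/funext => w; rewrite fct_sumE.
(* Additivity of the mean needs integrable summands, so integrability of the partial sums is carried
   through the induction. *)
apply: (@proj2 (\sum_i X i \in Lfun P 1)).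
elim/big_ind2: _ => [|x1 x2 y1 y2 [L1 <-] [L2 <-]|i _]; last by split.
- split; first exact: rpred0.
  by rewrite /mean (_ : 0 = cst 0)// expectation_cst.
- by split; [exact: rpredD|rewrite -meanD].
Qed.

(** This is nonnegativity of the variance. *)
Lemma mean_sqr_le X : X \in Lfun P 2%:E ->
  mean P X * mean P X <= mean P (fun w => X w * X w).
Proof.
move=> X2; have X1 := Lfun1_Lfun2 X2.
have := variance_ge0 P X.
rewrite varianceE// -lee_fin -(fineK (expectation_fin_num X1)).
rewrite -(@fineK _ 'E_P[X ^+ 2]%E); last first.
  by rewrite expectation_fin_num// expr2; exact: Lfun1M.
by rewrite -EFin_expe -EFinB !lee_fin subr_ge0 expr2.
Qed.

(** Follows from [2 X Y <= X^2 + Y^2], with no appeal to Cauchy-Schwarz. *)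
Lemma mean_mul_le (C : R) X Y : X \in Lfun P 2%:E -> Y \in Lfun P 2%:E ->
  mean P (fun w => X w * X w) <= C -> mean P (fun w => Y w * Y w) <= C ->
  mean P (fun w => X w * Y w) <= C.
Proof.
move=> X2 Y2 XC YC.
have XX := Lfun1M X2 X2; have YY := Lfun1M Y2 Y2; have XY := Lfun1M X2 Y2.
have : 0 <= mean P (fun w => (X w - Y w) ^+ 2).
  by apply: mean_ge0 => w; rewrite sqr_ge0.
rewrite (_ : (fun w => _) =
    (fun w => (X w * X w + Y w * Y w) + (- 2) * (X w * Y w))).
  by rewrite meanD ?Lfun1D ?Lfun1Z// meanD// meanZ//; lra.
by apply/funext => w; ring.
Qed.

End mean.

(** * Means under equal laws and under independence *)

(** Change of variables to the common law. Integrability is transferred first, through [|phi|],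
    because the signed change of variables requires it. *)
Lemma same_law_mean (d d' : measure_display) (Omega : measurableType d)
    (T : measurableType d') (R : realType) (P : probability Omega R)
    (V W : {RV P >-> T}) (phi : T -> R) :
  measurable_fun setT phi ->
  (forall A, measurable A -> distribution P V A = distribution P W A) ->
  phi \o V \in Lfun P 1 ->
  phi \o W \in Lfun P 1 /\ mean P (phi \o W) = mean P (phi \o V).
Proof.
move=> mphi VW iV.
have /Lfun1_integrable/integrableP[_ Voo] := iV.
have iW : phi \o W \in Lfun P 1.
  apply/Lfun1_integrable/integrableP; split.
    by apply/measurable_EFinP; exact: measurableT_comp.
  apply: le_lt_trans Voo.
  have mabs : measurable_fun setT (fun x => `|(phi x)%:E|%E).
    by apply: measurableT_comp => //; exact/measurable_EFinP.
  have := @ge0_integral_distribution _ _ _ _ _ P V _ mabs (fun=> abse_ge0 _).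
  have := @ge0_integral_distribution _ _ _ _ _ P W _ mabs (fun=> abse_ge0 _).
  move=> /= <- <-.
  rewrite le_eqVlt; apply/orP; left; apply/eqP.
  by apply: eq_measure_integral => A mA _ /=; rewrite VW.
split=> //; rewrite /mean unlock; congr fine.
have mE : measurable_fun setT (EFin \o phi) by exact/measurable_EFinP.
have := integral_distribution mE (iffLR (Lfun1_integrable _ _) iV).
have := integral_distribution mE (iffLR (Lfun1_integrable _ _) iW).
move=> /= <- <-.
by apply: eq_measure_integral => A mA _ /=; rewrite VW.
Qed.

Lemma integrable_distribution_id (d : measure_display)
    (Omega : measurableType d) (R : realType) (P : probability Omega R)
    (X : {RV P >-> R}) : (X : Omega -> R) \in Lfun P 1 ->
  (distribution P X).-integrable setT EFin /\
  (\int[distribution P X]_x x%:E = 'E_P[X])%E.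
Proof.
move=> /Lfun1_integrable iX.
have mE : measurable_fun setT (EFin : R -> \bar R) by exact/measurable_EFinP.
split; last by rewrite integral_distribution//= unlock.
apply/integrableP; split=> //.
have mabs : measurable_fun setT (fun x : R => `|x%:E|%E).
  exact: measurableT_comp.
rewrite (ge0_integral_distribution X mabs (fun=> abse_ge0 _)).
by have /integrableP[] := iX.
Qed.

(** Independence identifies the law of the pair with the product of the marginal laws; Fubini then
    factors the integral. *)
Lemma independent_mean (d : measure_display) (Omega : measurableType d)
    (R : realType) (P : probability Omega R) (X Y : Omega -> R) :
  X \in Lfun P 1 -> Y \in Lfun P 1 -> (fun w => X w * Y w) \in Lfun P 1 ->
  (forall A B : set R, measurable A -> measurable B ->
     P (X @^-1` A `&` Y @^-1` B) = (P (X @^-1` A) * P (Y @^-1` B))%E) ->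
  mean P (fun w => X w * Y w) = mean P X * mean P Y.
Proof.
move=> X1 Y1 XY1 indep.
have mX := Lfun_measurable X1; have mY := Lfun_measurable Y1.
pose U : {RV P >-> R} := mfun_Sub (mem_set mX).
pose V : {RV P >-> R} := mfun_Sub (mem_set mY).
have mUV : measurable_fun setT (fun w => (X w, Y w)).
  exact: measurable_fun_pair.
pose W : {RV P >-> (R * R)%type} := mfun_Sub (mem_set mUV).
pose mu := distribution P U; pose nu := distribution P V.
have prodE A : measurable A -> (mu \x nu)%E A = distribution P W A.
  apply: product_measure_unique => B C mB mC.
  exact: indep.
pose f (z : R * R) := (z.1 * z.2)%:E.
have mf : measurable_fun setT f.
  apply/measurable_EFinP; apply: measurable_funM.
    exact: measurable_fst.
  exact: measurable_snd.
have if_ : (mu \x nu)%E.-integrable setT f.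
  apply/integrableP; split=> //.
  have /Lfun1_integrable/integrableP[_] := XY1; apply: le_lt_trans.
  have mabs : measurable_fun setT (fun z => `|f z|%E) by exact: measurableT_comp.
  have := @ge0_integral_distribution _ _ _ _ _ P W _ mabs (fun=> abse_ge0 _).
  move=> /= <-; rewrite le_eqVlt; apply/orP; left; apply/eqP.
  by apply: eq_measure_integral => A mA _ /=; exact: prodE.
have intE : (\int[P]_w (X w * Y w)%:E = \int[(mu \x nu)%E]_z f z)%E.
  have := @integral_distribution _ _ _ _ _ P W f mf
    (iffLR (Lfun1_integrable _ _) XY1).
  move=> /= <-; apply: eq_measure_integral => A mA _ /=.
  by rewrite -prodE.
have [imu Emu] : mu.-integrable setT EFin /\ (\int[mu]_x x%:E = 'E_P[X])%E.
  exact: (@integrable_distribution_id _ _ _ _ U).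
have [inu Enu] : nu.-integrable setT EFin /\ (\int[nu]_x x%:E = 'E_P[Y])%E.
  exact: (@integrable_distribution_id _ _ _ _ V).
rewrite {1}/mean unlock intE -integral12_prod_meas1//.
under eq_integral => x _.
  rewrite /fubini_F /f /=.
  under eq_integral => y _ do rewrite EFinM.
  rewrite integralZl// Enu -(fineK (expectation_fin_num Y1)).
  over.
by rewrite integralZr// Emu fineM// expectation_fin_num.
Qed.

Lemma independent_mean_indic (d : measure_display) (Omega : measurableType d)
    (R : realType) (P : probability Omega R) (E : set Omega) (X : Omega -> R) :
  measurable E -> X \in Lfun P 1 ->
  (forall A : set R, measurable A ->
     P (X @^-1` A `&` E) = (P (X @^-1` A) * P E)%E) ->
  mean P (fun w => \1_E w * X w) = fine (P E) * mean P X.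
Proof.
move=> mE X1 indep; have mX := Lfun_measurable X1.
rewrite -mean_indic//; apply: independent_mean => //.
- rewrite (_ : \1_E = fun w => \1_E w * cst 1 w :> R).
    by apply: Lfun_indicM => //; exact: Lfun_cst.
  by apply/funext => w; rewrite /= mulr1.
- exact: Lfun_indicM.
- move=> A B mA mB; rewrite setIC [RHS]muleC.
  have mXB : measurable (X @^-1` B) by rewrite -[X in measurable X]setTI; exact: mX.
  (* A preimage under the indicator is the whole space, [E], its complement or empty, in this order
     below. *)
  rewrite preimage_indic; case: ifPn => _; case: ifPn => _.
  + by rewrite setIT probability_setT mule1.
  + exact: indep.
  + rewrite -setDE measureD//; last first.
      by rewrite (le_lt_trans (probability_le1 _ _))// ltry.
    rewrite probability_setC// muleBr ?mule1//.
      by congr (_ - _)%E; exact: indep.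
    exact: fin_num_measure.
  + by rewrite setI0 measure0 mule0.
Qed.

(** * Measurability of matrix operations *)

Lemma measurable_invr (R : realType) (d : measure_display)
    (S : measurableType d) (u : S -> R) :
  measurable_fun setT u -> measurable_fun setT (fun x => (u x)^-1).
Proof.
(* Squaring makes the base of the real power nonnegative whatever the sign of [u]; where [u]
   vanishes both sides are 0, as [0^-1 = 0]. *)
move=> mu; rewrite (_ : (fun _ => _) = (fun x => u x * (u x ^+ 2) `^ (-1))).
  apply: measurable_funM => //.
  apply: (measurableT_comp (measurable_powR _)).
  exact: measurable_funX.
apply/funext => x; rewrite powR_inv1 ?sqr_ge0//.
have [->|ux0] := eqVneq (u x) 0; first by rewrite invr0 mul0r.
by field.
Qed.

Definition measurable_mx (R : realType) (d : measure_display)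
    (S : measurableType d) (m n : nat) (A : S -> 'M[R]_(m, n)) : Prop :=
  forall i j, measurable_fun setT (fun x => A x i j).

Section measurable_mx.
Context (R : realType) (d : measure_display) (S : measurableType d).

Lemma measurable_mx_sum (m n k : nat) (A : 'I_k -> S -> 'M[R]_(m, n)) :
  (forall l, measurable_mx (A l)) -> measurable_mx (fun x => \sum_l A l x).
Proof.
move=> mA i j; under eq_fun do rewrite summxE.
by apply: measurable_sum => l; exact: mA.
Qed.

Lemma measurable_mx_mul (m n p : nat) (A : S -> 'M[R]_(m, n))
    (B : S -> 'M[R]_(n, p)) :
  measurable_mx A -> measurable_mx B -> measurable_mx (fun x => A x *m B x).
Proof.
move=> mA mB i j; under eq_fun do rewrite mxE.
by apply: measurable_sum => l; exact: measurable_funM.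
Qed.

Lemma measurable_mx_det (n : nat) (A : S -> 'M[R]_n) :
  measurable_mx A -> measurable_fun setT (fun x => \det (A x)).
Proof.
move=> mA; apply: measurable_sum => s; apply: measurable_funM => //.
by apply: measurable_prod => i _; exact: mA.
Qed.

Lemma measurable_mx_inv (n : nat) (A : S -> 'M[R]_n) :
  measurable_mx A -> measurable_mx (fun x => invmx (A x)).
Proof.
move=> mA i j; have mdet := measurable_mx_det mA.
(* The adjugate formula holds where the determinant is nonzero; elsewhere [invmx] returns the matrix
   itself by default. *)
rewrite (_ : (fun _ => _) = (fun x =>
    if \det (A x) == 0 then A x i j else (\det (A x))^-1 * \adj (A x) i j)).
  apply: measurable_fun_if => //.
  - exact: measurable_fun_eqr.
  - exact: measurable_funTS.
  - apply: measurable_funTS; apply: measurable_funM.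
      exact: measurable_invr.
    under eq_fun do rewrite mxE.
    rewrite /cofactor; apply: measurable_funM => //.
    by apply: measurable_mx_det => a b; under eq_fun do rewrite !mxE; exact: mA.
apply/funext => x; rewrite /invmx unitmxE unitfE.
by case: eqP => //= _; rewrite mxE.
Qed.

End measurable_mx.

(** * Counting pairs of index tuples that share an index *)

(** Exchanging sum and product leaves a factor 1 at coordinate [j] and a factor [n] at each other
    one. Multiplying by [n] avoids the exponent [k - 1]. *)
Lemma card_ffun_at (k n : nat) (j : 'I_k) (a : 'I_n) :
  (n * \sum_(t : {ffun 'I_k -> 'I_n}) (t j == a) = n ^ k)%N.
Proof.
pose F (i : 'I_k) (b : 'I_n) : nat := if i == j then (b == a) : nat else 1%N.
have -> : (\sum_(t : {ffun 'I_k -> 'I_n}) (t j == a) =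
           \prod_(i < k) \sum_(b < n) F i b)%N.
  rewrite bigA_distr_bigA /=; apply: eq_bigr => t _.
  rewrite (bigD1 j)//= /F eqxx big1 ?muln1// => i /negbTE ->//.
rewrite -[in RHS](card_ord k) -prod_nat_const (bigD1 j)//= [RHS](bigD1 j)//=.
have -> : (\sum_(b < n) F j b = 1)%N.
  rewrite (bigD1 a)//= /F !eqxx big1// => b /negbTE ba.
  by rewrite ba.
rewrite mul1n; congr (_ * _)%N.
apply: eq_bigr => i /negbTE ij.
by rewrite /F; under eq_bigr do rewrite ij; rewrite sum1_card card_ord.
Qed.

(** A union bound over the [k^2] pairs of positions: for fixed [s], [i], [j], a fraction [1/n] of
    the tuples [t] satisfies [s i = t j]. *)
Lemma card_meeting_pairs (k n : nat) :
  (n * \sum_(s : {ffun 'I_k -> 'I_n}) \sum_(t : {ffun 'I_k -> 'I_n})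
     [exists i, exists j, s i == t j] <= k ^ 2 * (n ^ k) ^ 2)%N.
Proof.
have -> : (k ^ 2 * (n ^ k) ^ 2 = n * \sum_(s : {ffun 'I_k -> 'I_n})
    \sum_(t : {ffun 'I_k -> 'I_n}) \sum_(i < k) \sum_(j < k) (s i == t j))%N.
  rewrite big_distrr /=.
  under eq_bigr => s _.
    rewrite exchange_big big_distrr /=.
    under eq_bigr => i _.
      rewrite exchange_big big_distrr /=.
      under eq_bigr => j _.
        under eq_bigr do rewrite eq_sym.
        rewrite card_ffun_at.
        over.
      over.
    over.
  by rewrite /= !sum_nat_const !card_ord card_ffun !card_ord; ring.
rewrite leq_mul2l; apply/orP; right.
apply: leq_sum => s _; apply: leq_sum => t _.
case: existsP => //= -[i /existsP[j st]].
by rewrite (bigD1 i)//= (bigD1 j)//= st.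
Qed.

(** * Variance of an average over random draws *)

(** Here [a b s] stands for the event that draw [b] equals [s], and [bad] marks the pairs allowed to
    be correlated. The variance is the average over [(b, b')] of the covariances of the summands:
    the diagonal gives [C / B], and for distinct draws the covariance is an average over [(s, t)] to
    which only bad pairs contribute. *)
Lemma resample_variance_le (d : measure_display) (Omega : measurableType d)
    (R : realType) (P : probability Omega R) (B : nat) (K : finType)
    (a : 'I_B -> K -> set Omega) (x : K -> Omega -> R) (C : R) (bad : rel K)
    (S : Omega -> R) :
  (0 < B)%N -> (0 < #|K|)%N ->
  (forall b s, measurable (a b s)) ->
  (forall b s, fine (P (a b s)) = #|K|%:R^-1) ->
  (forall b b' s t, b != b' ->
     fine (P (a b s `&` a b' t)) = #|K|%:R^-1 * #|K|%:R^-1) ->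
  (forall b s t, s != t -> a b s `&` a b t = set0) ->
  (forall s, x s \in Lfun P 2%:E) ->
  (forall s, mean P (fun w => x s w * x s w) <= C) ->
  (forall b s, mean P (fun w => \1_(a b s) w * x s w) =
     fine (P (a b s)) * mean P (x s)) ->
  (forall b b' s t, mean P (fun w => \1_(a b s `&` a b' t) w * (x s w * x t w)) =
     fine (P (a b s `&` a b' t)) * mean P (fun w => x s w * x t w)) ->
  (forall s t, ~~ bad s t ->
     mean P (fun w => x s w * x t w) = mean P (x s) * mean P (x t)) ->
  (forall w, S w = B%:R^-1 * \sum_b \sum_s (\1_(a b s) w * x s w)) ->
  mean P (fun w => S w * S w) - mean P S * mean P S <=
  C / B%:R + 2 * C * ((\sum_s \sum_t (bad s t))%N%:R / (#|K|%:R ^+ 2)).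
Proof.
move=> B0 K0 ma Pa Paa a0 x2 xC indep1 indep2 cov0 /funext SE.
have x1 s : x s \in Lfun P 1 by exact: Lfun1_Lfun2.
have xx1 s t : (fun w => x s w * x t w) \in Lfun P 1 by exact: Lfun1M.
have K0R : 0 < #|K|%:R :> R by rewrite ltr0n.
have B0R : 0 < B%:R :> R by rewrite ltr0n.
have C0 : 0 <= C.
  have /card_gt0P[s _] := K0.
  by apply: le_trans (xC s); apply: mean_ge0 => w; rewrite -expr2 sqr_ge0.
set delta := 2 * C * _.
have delta0 : 0 <= delta.
  by rewrite /delta !mulr_ge0// ?invr_ge0 ?exprn_ge0// ler0n.
pose Y b w := \sum_s (\1_(a b s) w * x s w).
have Y2 b : Y b \in Lfun P 2%:E.
  by apply: Lfun2_sum => s; exact: Lfun2_indicM.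
have Y1 b : Y b \in Lfun P 1 by exact: Lfun1_Lfun2.
pose m := #|K|%:R^-1 * \sum_s mean P (x s).
have meanY b : mean P (Y b) = m.
  rewrite /Y mean_sum => [|s]; last by apply: Lfun_indicM.
  by rewrite /m mulr_sumr; apply: eq_bigr => s _; rewrite indep1 Pa.
have meanS : mean P S = m.
  rewrite SE meanZ; last exact: Lfun_sum.
  rewrite mean_sum//; under eq_bigr do rewrite meanY.
  by rewrite sumr_const card_ord -[m *+ _]mulr_natl mulrA mulVf ?mul1r ?gt_eqF.
have meanYY b b' : mean P (fun w => Y b w * Y b' w) =
    \sum_s \sum_t fine (P (a b s `&` a b' t)) * mean P (fun w => x s w * x t w).
  have mI s t : measurable (a b s `&` a b' t) by exact: measurableI.
  rewrite (_ : (fun w => _) = fun w => \sum_s \sum_t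
      \1_(a b s `&` a b' t) w * (x s w * x t w)).
    rewrite mean_sum => [|s]; last first.
      by apply: Lfun_sum => t; exact: Lfun_indicM.
    apply: eq_bigr => s _; rewrite mean_sum => [|t]; last exact: Lfun_indicM.
    by apply: eq_bigr => t _; rewrite indep2.
  apply/funext => w; rewrite /Y mulr_suml; apply: eq_bigr => s _.
  rewrite mulr_sumr; apply: eq_bigr => t _.
  by rewrite indicI /=; ring.
have mm : m * m = \sum_s \sum_t
    #|K|%:R^-1 * #|K|%:R^-1 * (mean P (x s) * mean P (x t)).
  rewrite /m mulrACA mulr_suml mulr_sumr; apply: eq_bigr => s _.
  by rewrite mulr_sumr mulr_sumr; apply: eq_bigr => t _.
have covY b b' :
    mean P (fun w => Y b w * Y b' w) - m * m <= (b == b')%:R * C + delta.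
  (* On the diagonal the events of one draw are disjoint, so only [s = t] survives and the second
     moment is an average of terms at most [C]. *)
  rewrite meanYY; case: eqVneq => [<-{b'}|bb'].
    rewrite mul1r (le_trans _ (_ : C <= _)) ?lerDl//.
    rewrite lerBlDr (le_trans _ (_ : C <= _)) ?lerDl -?expr2 ?sqr_ge0//.
    apply: (@le_trans _ _ (\sum_(s : K) #|K|%:R^-1 * C)).
      apply: ler_sum => s _; rewrite (bigD1 s)//= big1 ?addr0 => [|t ts].
        by rewrite setIid Pa ler_wpM2l// invr_ge0.
      by rewrite a0 1?eq_sym// measure0 mul0r.
    by rewrite sumr_const -[_ *+ _]mulr_natl mulrA divff ?mul1r// gt_eqF.
  have -> : delta = \sum_s \sum_t 2 * C * ((bad s t)%:R / #|K|%:R ^+ 2).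
    rewrite /delta natr_sum mulr_suml mulr_sumr; apply: eq_bigr => s _.
    by rewrite natr_sum mulr_suml mulr_sumr; apply: eq_bigr.
  rewrite mul0r add0r mm -sumrB; apply: ler_sum => s _.
  rewrite -sumrB; apply: ler_sum => t _; rewrite Paa// -mulrBr.
  rewrite [leRHS](_ : _ = #|K|%:R^-1 * #|K|%:R^-1 * (2 * C * (bad s t)%:R)).
    rewrite ler_wpM2l ?mulr_ge0 ?invr_ge0//.
    case: (boolP (bad s t)) => [_|/cov0->]; last by rewrite subrr mulr0.
    (* The factor 2: the mixed moment is at most [C], and minus the product of the means is at most
       half the sum of their squares, again at most [C]. *)
    rewrite mulr1; have xt := xC t; have xs := xC s.
    have xst : mean P (fun w => x s w * x t w) <= C by exact: mean_mul_le.
    have := mean_sqr_le (x2 s); have := mean_sqr_le (x2 t).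
    nra.
  by rewrite expr2 invfM; ring.
have SS : mean P (fun w => S w * S w) =
    (B%:R ^+ 2)^-1 * \sum_b \sum_b' mean P (fun w => Y b w * Y b' w).
  have YY1 b b' : (fun w => Y b w * Y b' w) \in Lfun P 1 by exact: Lfun1M.
  rewrite (_ : (fun w => _) = fun w =>
      (B%:R ^+ 2)^-1 * \sum_b \sum_b' Y b w * Y b' w).
    rewrite meanZ; last by apply: Lfun_sum => b; exact: Lfun_sum.
    rewrite mean_sum => [|b]; last exact: Lfun_sum.
    by congr (_ * _); apply: eq_bigr => b _; rewrite mean_sum.
  apply/funext => w; rewrite SE -/(Y _ w) expr2 invfM mulrACA; congr (_ * _).
  by rewrite mulr_suml; apply: eq_bigr => b _; rewrite mulr_sumr.
(* The squared mean is spread over all pairs of draws so that it can be subtracted term by term. *)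
have BB : m * m = (B%:R ^+ 2)^-1 * \sum_(b < B) \sum_(b' < B) (m * m).
  rewrite !sumr_const card_ord -mulrnA -[m * m *+ _]mulr_natl natrM -expr2 mulrA.
  by rewrite mulVf ?mul1r// expf_neq0// gt_eqF.
rewrite SS meanS {1}BB -mulrBr -sumrB.
apply: (@le_trans _ _ ((B%:R ^+ 2)^-1 * \sum_(b < B) (C + B%:R * delta))).
  rewrite ler_wpM2l ?invr_ge0 ?exprn_ge0 ?ler0n//.
  apply: ler_sum => b _; rewrite -sumrB.
  apply: (@le_trans _ _ (\sum_(b' < B) ((b == b')%:R * C + delta))).
    by apply: ler_sum.
  rewrite big_split /= -mulr_suml (bigD1 b)//= eqxx big1 => [|b' /negbTE].
    by rewrite addr0 mul1r sumr_const card_ord -[delta *+ _]mulr_natl.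
  by rewrite eq_sym => ->.
rewrite sumr_const card_ord -[(C + _) *+ _]mulr_natl le_eqVlt; apply/orP; left.
by apply/eqP; field; rewrite gt_eqF.
Qed.

(** * Quadratic forms of covariance matrices as scalar variances *)

Definition lincomb (R : realType) (q : nat) (v h : 'cV[R]_q) : R :=
  \sum_i v i ord0 * h i ord0.

Lemma quad_formE (R : realType) (q : nat) (A : 'M[R]_q) (v : 'cV[R]_q) :
  quad_form A v = \sum_i \sum_j v i ord0 * v j ord0 * A i j.
Proof.
rewrite /quad_form mxE exchange_big /=; apply: eq_bigr => j _.
by rewrite mxE mulr_suml; apply: eq_bigr => i _; rewrite mxE; ring.
Qed.

Lemma quad_form_var_mx (d : measure_display) (Omega : measurableType d)
    (R : realType) (P : probability Omega R) (q : nat)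
    (X : Omega -> 'cV[R]_q) (v : 'cV[R]_q) :
  square_integrable P X ->
  quad_form (var_mx P X) v =
  mean P (fun w => lincomb v (X w) * lincomb v (X w)) -
  mean P (fun w => lincomb v (X w)) * mean P (fun w => lincomb v (X w)).
Proof.
move=> X2; have X1 i := Lfun1_Lfun2 (X2 i).
have XX1 i j := Lfun1M (X2 i) (X2 j).
have -> : mean P (fun w => lincomb v (X w)) =
    \sum_i v i ord0 * mean P (fun w => X w i ord0).
  rewrite mean_sum => [|i]; last exact: Lfun1Z.
  by apply: eq_bigr => i _; rewrite meanZ.
have -> : mean P (fun w => lincomb v (X w) * lincomb v (X w)) =
    \sum_i \sum_j v i ord0 * v j ord0 * mean P (fun w => X w i ord0 * X w j ord0).
  rewrite (_ : (fun w => _) = fun w => \sum_i \sum_j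
      v i ord0 * v j ord0 * (X w i ord0 * X w j ord0)).
    rewrite mean_sum => [|i]; last by apply: Lfun_sum => j; exact: Lfun1Z.
    apply: eq_bigr => i _; rewrite mean_sum => [|j]; last exact: Lfun1Z.
    by apply: eq_bigr => j _; rewrite meanZ.
  apply/funext => w; rewrite /lincomb mulr_suml; apply: eq_bigr => i _.
  by rewrite mulr_sumr; apply: eq_bigr => j _; ring.
rewrite quad_formE mulr_suml -sumrB; apply: eq_bigr => i _.
rewrite mulr_sumr -sumrB; apply: eq_bigr => j _.
rewrite mxE covarianceE//; last exact: XX1.
rewrite fineB ?fin_numM ?expectation_fin_num//; last exact: XX1.
by rewrite fineM ?expectation_fin_num// /mean; ring.
Qed.

Lemma quad_formB (R : realType) (q : nat) (A B : 'M[R]_q) (v : 'cV[R]_q) :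
  quad_form (A - B) v = quad_form A v - quad_form B v.
Proof. by rewrite /quad_form mulmxBr mulmxBl !mxE. Qed.

Lemma lincombZ (R : realType) (q : nat) (v h : 'cV[R]_q) (c : R) :
  lincomb v (c *: h) = c * lincomb v h.
Proof. by rewrite mulr_sumr; apply: eq_bigr => i _; rewrite mxE; ring. Qed.

Lemma lincomb_sum (R : realType) (q : nat) (I : finType) (v : 'cV[R]_q)
    (h : I -> 'cV[R]_q) :
  lincomb v (\sum_i h i) = \sum_i lincomb v (h i).
Proof.
rewrite /lincomb exchange_big /=; apply: eq_bigr => i _.
by rewrite summxE mulr_sumr.
Qed.

Lemma norm_mx_entry (R : realType) (m n : nat) (A : 'M[R]_(m, n)) i j :
  `|A i j| <= `|A|.
Proof.
rewrite [leRHS]mx_normrE.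
by rewrite (le_bigmax _ (fun ij : 'I_m * 'I_n => `|A ij.1 ij.2|) (i, j)).
Qed.

(** * The kernel as a function of the data tuple, and its moments *)

(** Rectangles are replaced by general measurable sets one block at a time, through two uses of
    [joint_independent]. *)
Lemma joint_joint_independent (d d' : measure_display)
    (Omega : measurableType d) (T : measurableType d') (R : realType)
    (P : probability Omega R) (U : choiceType) (X : U -> {RV P >-> T})
    (n m : nat) (sigma : 'I_n -> U) (tau : 'I_m -> U) :
  mutually_independent P (fun i => generated_events measurable (X i)) ->
  injective sigma -> injective tau -> (forall i j, sigma i != tau j) ->
  forall A B, measurable A -> measurable B ->
    P (joint (X \o sigma) @^-1` A `&` joint (X \o tau) @^-1` B) =
    (P (joint (X \o sigma) @^-1` A) * P (joint (X \o tau) @^-1` B))%E.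
Proof.
move=> indep sigma_inj tau_inj sigma_tau A B mA mB.
have mpre k (rho : 'I_k -> U) (C : 'I_k -> set T) :
    (forall i, measurable (C i)) ->
    measurable (\bigcap_i ((X \o rho) i @^-1` C i)).
  move=> mC; apply: fin_bigcap_measurable => // i _.
  by rewrite -[X in measurable X]setTI; apply: measurable_funP.
have mjoint k (rho : 'I_k -> U) C : measurable C ->
    measurable (joint (X \o rho) @^-1` C).
  by move=> mC; rewrite -[X in measurable X]setTI; exact: measurable_joint.
rewrite setIC [RHS]muleC; apply: joint_independent mB; first exact: mjoint.
move=> B' mB'; rewrite setIC [RHS]muleC.
apply: joint_independent mA; first exact: mpre.
move=> A' mA'; apply: (mutually_independent_blocks indep sigma_inj tau_inj) => //.
  by move=> i; exists (A' i) => //; rewrite setTI.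
by move=> i; exists (B' i) => //; rewrite setTI.
Qed.

(** Taking the whole data tuple as argument, with [s] as a parameter, lets results on the law of
    [joint] apply to kernels at several index tuples at once. *)
Definition kernel_lin (R : realType) (T : Type) (q : nat) (g : T -> 'M[R]_q)
    (f : T -> 'cV[R]_q) (v : 'cV[R]_q) (k n : nat) (s : 'I_k -> 'I_n)
    (x : n.-tuple T) : R :=
  lincomb v (kernel_h g f (fun j => tnth x (s j))).

Lemma measurable_kernel_lin (R : realType) (d : measure_display)
    (T : measurableType d) (F : probability T R) (q : nat)
    (g : T -> 'M[R]_q) (f : T -> 'cV[R]_q) (v : 'cV[R]_q) (k n : nat)
    (s : 'I_k -> 'I_n) :
  integrable_mx F g -> integrable_mx F f ->
  measurable_fun setT (kernel_lin g f v s).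
Proof.
move=> g_int f_int.
have mcoord m (u : T -> 'M[R]_(q, m)) : integrable_mx F u ->
    measurable_mx (fun x : n.-tuple T => \sum_j u (tnth x (s j))).
  move=> u_int; apply: measurable_mx_sum => j a b.
  apply: (measurableT_comp (Lfun_measurable (u_int a b))).
  exact: measurable_tnth.
apply: measurable_sum => i; apply: measurable_funM => //.
apply: measurable_mx_mul; last exact: mcoord.
by apply: measurable_mx_inv; exact: mcoord.
Qed.

(** The class H controls only index tuples with entries below [k]; since [s] has at most [k]
    distinct values, an injective relabelling brings it to that form. *)
Lemma relabel_initial (k n : nat) (s : 'I_k -> 'I_n) :
  exists rho : 'I_n -> nat, injective rho /\ forall j, (rho (s j) < k)%N.
Proof.
(* Values of [s] are listed first, hence have positions below [k]; appending the full enumeration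
   makes the position injective on all indices. *)
exists (fun i => index i (codom s ++ enum 'I_n)); split.
  have mem i : i \in codom s ++ enum 'I_n by rewrite mem_cat mem_enum orbT.
  by move=> i i'; apply: index_inj.
move=> j; rewrite index_cat codom_f -[ltnRHS]card_ord -(size_codom s).
by rewrite index_mem codom_f.
Qed.

Section kernel_moments.
Context (R : realType) (d d' : measure_display).
Context (Omega : measurableType d) (T : measurableType d').
Context (P : probability Omega R) (F : probability T R).
Context (q : nat) (g : T -> 'M[R]_q) (f : T -> 'cV[R]_q) (v : 'cV[R]_q).
Context (Z Z' : nat -> {RV P >-> T}).
Context (g_int : integrable_mx F g) (f_int : integrable_mx F f).
Context (Z_iid : iid_pair F Z Z').

(** One family holds data and copies, so that an index map may mix the two. *)
Let X (i : nat + nat) : {RV P >-> T} :=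
  match i with inl a => Z a | inr a => Z' a end.

Let lawX i : has_law F (X i).
Proof. by have [lawZ lawZ' _] := Z_iid; case: i. Qed.

Let indepX : mutually_independent P (fun i => generated_events measurable (X i)).
Proof.
have [_ _ indep] := Z_iid.
rewrite (_ : (fun _ => _) = fun i : nat + nat => match i with
  | inl a => generated_events measurable (Z a)
  | inr a => generated_events measurable (Z' a) end)//.
by apply/funext => -[].
Qed.

Let data n (i : 'I_n) : nat + nat := inl (val i).
Let copy n (i : 'I_n) : nat + nat := inr (val i).

Let data_inj n : injective (@data n).
Proof. by move=> i i' [] /val_inj. Qed.

Let copy_inj n : injective (@copy n).
Proof. by move=> i i' [] /val_inj. Qed.

Let sample n := joint (fun i : 'I_n => Z i).

Let mkernel k n (s : 'I_k -> 'I_n) : measurable_fun setT (kernel_lin g f v s).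
Proof. exact: measurable_kernel_lin g_int f_int. Qed.

(** The class H bounds the kernel at the relabelled tuple, entry by entry, which yields the weights
    [|v_i| |v_j|]. Relabelling keeps the joint law of the data, so the bound returns to [s]. *)
Lemma kernel_lin_sqr_le (k : nat) (M : R) : (0 < k)%N ->
  (forall t : 'I_k -> 'I_k,
    let H := fun w => kernel_h g f (fun j => Z (t j) w) in
    integrable_mx P (fun w => H w *m (H w)^T) /\
    `| mean_mx P (fun w => H w *m (H w)^T) | <= M) ->
  forall n (s : 'I_k -> 'I_n),
  (fun w => kernel_lin g f v s (sample n w)) \in Lfun P 2%:E /\
  mean P (fun w =>
      kernel_lin g f v s (sample n w) * kernel_lin g f v s (sample n w)) <=
    \sum_i \sum_j `|v i ord0| * `|v j ord0| * M.
Proof.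
move=> k0 HM n s.
have [rho [rho_inj rho_lt]] := relabel_initial s.
pose t j : 'I_k := Ordinal (rho_lt j).
pose H w := kernel_h g f (fun j => Z (t j) w).
have [HH1 HHM] : integrable_mx P (fun w => H w *m (H w)^T) /\
  `|mean_mx P (fun w => H w *m (H w)^T)| <= M := HM t.
pose x w := kernel_lin g f v s (joint (X \o (fun i => inl (rho i))) w).
have xE w : x w = lincomb v (H w).
  rewrite /x /kernel_lin /H; congr (lincomb v (kernel_h g f _)).
  by apply/funext => j; rewrite tnth_mktuple.
have HHE w i j : (H w *m (H w)^T) i j = H w i ord0 * H w j ord0.
  by rewrite mxE big_ord1 [X in _ * X]mxE.
have {}HH1 i j : (fun w => H w i ord0 * H w j ord0) \in Lfun P 1.
  by have := HH1 i j; under eq_fun do rewrite HHE.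
have {}HHM i j : `|mean P (fun w => H w i ord0 * H w j ord0)| <= M.
  apply: le_trans HHM; apply: le_trans (norm_mx_entry _ i j).
  rewrite [X in _ <= `|X|]mxE -/(mean P _).
  rewrite (_ : (fun w => (H w *m (H w)^T) i j) =
    fun w => H w i ord0 * H w j ord0)//.
  by apply/funext => w; rewrite HHE.
have xxE : (fun w => x w * x w) =
    fun w => \sum_i \sum_j v i ord0 * v j ord0 * (H w i ord0 * H w j ord0).
  apply/funext => w; rewrite xE /lincomb mulr_suml; apply: eq_bigr => i _.
  by rewrite mulr_sumr; apply: eq_bigr => j _; ring.
have xx1 : (fun w => x w * x w) \in Lfun P 1.
  by rewrite xxE; apply: Lfun_sum => i; apply: Lfun_sum => j; exact: Lfun1Z.
have xxM : mean P (fun w => x w * x w) <=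
    \sum_i \sum_j `|v i ord0| * `|v j ord0| * M.
  rewrite xxE mean_sum => [|i]; last by apply: Lfun_sum => j; exact: Lfun1Z.
  apply: ler_sum => i _; rewrite mean_sum => [|j]; last exact: Lfun1Z.
  apply: ler_sum => j _; rewrite meanZ//.
  by rewrite (le_trans (ler_norm _))// normrM normrM ler_wpM2l ?mulr_ge0.
have mphi2 : measurable_fun setT
    (fun y => kernel_lin g f v s y * kernel_lin g f v s y).
  by apply: measurable_funM; exact: mkernel.
have inl_rho_inj : injective (fun i => inl (rho i) : nat + nat).
  by move=> i i' [] /rho_inj.
have law := joint_same_law lawX indepX inl_rho_inj (@data_inj n).
have [yy1 yyE] := same_law_mean mphi2 law xx1.
split; last by rewrite [leLHS]yyE.
apply: sqr_Lfun1_Lfun2 => //.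
by apply: (measurableT_comp (mkernel s)); exact: measurable_joint.
Qed.

Lemma kernel_lin_disjoint (k n : nat) (s t : 'I_k -> 'I_n) :
  (forall i j, s i != t j) ->
  (forall r : 'I_k -> 'I_n,
    (fun w => kernel_lin g f v r (sample n w)) \in Lfun P 2%:E) ->
  mean P (fun w =>
      kernel_lin g f v s (sample n w) * kernel_lin g f v t (sample n w)) =
  mean P (fun w => kernel_lin g f v s (sample n w)) *
    mean P (fun w => kernel_lin g f v t (sample n w)).
Proof.
move=> st x2.
(* Off the range of s, replacing the data by the independent copy changes
   neither the joint law nor x_s, and turns x_t into a function of the copy. *)
pose tau (i : 'I_n) : nat + nat := if i \in codom s then data i else copy i.
have tau_inj : injective tau.
  move=> i i'; rewrite /tau; case: ifP => _; case: ifP => _ //.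
    exact: data_inj.
  exact: copy_inj.
have mst : measurable_fun setT
    (fun y => kernel_lin g f v s y * kernel_lin g f v t y).
  by apply: measurable_funM; exact: mkernel.
have [ytau1 ytauE] := same_law_mean mst
  (joint_same_law lawX indepX (@data_inj n) tau_inj) (Lfun1M (x2 s) (x2 t)).
have [t1 tE] := same_law_mean (mkernel t)
  (joint_same_law lawX indepX (@data_inj n) (@copy_inj n)) (Lfun1_Lfun2 (x2 t)).
have tauE :
    (fun y => kernel_lin g f v s y * kernel_lin g f v t y) \o joint (X \o tau) =
    fun w => kernel_lin g f v s (sample n w) *
             kernel_lin g f v t (joint (X \o @copy n) w).
  apply/funext => w /=; congr (_ * _); rewrite /kernel_lin;
    congr (lincomb v (kernel_h g f _)).
    by apply/funext => j; rewrite !tnth_mktuple /= /tau codom_f.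
  apply/funext => j; rewrite !tnth_mktuple /= /tau ifN//.
  by apply/codomP => -[i /esym/eqP]; rewrite (negbTE (st _ _)).
rewrite tauE in ytau1 ytauE.
rewrite -[LHS]ytauE -[in RHS]tE; apply: independent_mean => //.
  exact: Lfun1_Lfun2.
move=> A B mA mB.
have pre (r : 'I_k -> 'I_n) C :
    measurable C -> measurable (kernel_lin g f v r @^-1` C).
  by move=> mC; rewrite -[X in measurable X]setTI; exact: (mkernel r).
(* Data and copies lie in different summands of [nat + nat], so disjointness of the two blocks holds
   by computation. *)
have := joint_joint_independent indepX (@data_inj n) (@copy_inj n)
  (fun _ _ => isT) (pre s A mA) (pre t B mB).
exact.
Qed.

End kernel_moments.

(** * Variance of the resampled V-statistic *)

Lemma V_stat_variance_le (R : realType) (d d' : measure_display)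
    (Omega : measurableType d) (T : measurableType d')
    (P : probability Omega R) (F : probability T R)
    (q : nat) (g : T -> 'M[R]_q) (f : T -> 'cV[R]_q) (v : 'cV[R]_q)
    (Z Z' : nat -> {RV P >-> T}) (n k B : nat) (M C : R)
    (J : 'I_B -> Omega -> {ffun 'I_k -> 'I_n}) :
  integrable_mx F g -> integrable_mx F f -> iid_pair F Z Z' ->
  uniform_resampling Z J ->
  (0 < n)%N -> (0 < k)%N -> (0 < B)%N ->
  (forall t : 'I_k -> 'I_k,
    let H := fun w => kernel_h g f (fun j => Z (t j) w) in
    integrable_mx P (fun w => H w *m (H w)^T) /\
    `| mean_mx P (fun w => H w *m (H w)^T) | <= M) ->
  square_integrable P (V_stat (kernel_h g f) Z J) ->
  C = \sum_i \sum_j `|v i ord0| * `|v j ord0| * M ->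
  quad_form (var_mx P (V_stat (kernel_h g f) Z J)) v <=
  C / B%:R + 2 * C * (k%:R ^+ 2 / n%:R).
Proof.
move=> g_int f_int Z_iid [mJ PJ indep] n0 k0 B0 HM V2 CE.
pose W := joint (fun i : 'I_n => Z i).
pose x (s : {ffun 'I_k -> 'I_n}) w := kernel_lin g f v s (W w).
pose a b (s : {ffun 'I_k -> 'I_n}) := J b @^-1` [set s].
pose bad (s t : {ffun 'I_k -> 'I_n}) := [exists i, exists j, s i == t j].
have x2 (s : 'I_k -> 'I_n) : (fun w => kernel_lin g f v s (W w)) \in Lfun P 2%:E.
  by have [] := kernel_lin_sqr_le v g_int f_int Z_iid k0 HM s.
have xC (s : {ffun 'I_k -> 'I_n}) : mean P (fun w => x s w * x s w) <= C.
  by rewrite CE; have [] := kernel_lin_sqr_le v g_int f_int Z_iid k0 HM s.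
have cardK : #|{ffun 'I_k -> 'I_n}| = (n ^ k)%N by rewrite card_ffun !card_ord.
have aE b s w : (w \in a b s) = (J b w == s).
  by apply/idP/eqP => [/set_mem|/mem_set].
have mphi (s : 'I_k -> 'I_n) : measurable_fun setT (kernel_lin g f v s).
  exact: measurable_kernel_lin g_int f_int.
have pair_indep b b' s t (phi : n.-tuple T -> R) : measurable_fun setT phi ->
    phi \o W \in Lfun P 1 ->
    mean P (fun w => \1_(a b s `&` a b' t) w * (phi \o W) w) =
    fine (P (a b s `&` a b' t)) * mean P (phi \o W).
  move=> mphi' phi1; apply: independent_mean_indic => //.
    by apply: measurableI; exact: mJ.
  move=> A mA; rewrite comp_preimage.
  (* The event on draws [b] and [b'] becomes a rectangle over all draws, with full sides at other
     [c]; the case [b = b'] needs no separate treatment. *)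
  pose D c := [set u | (c = b -> u = s) /\ (c = b' -> u = t)].
  have DE : a b s `&` a b' t = \bigcap_c (J c @^-1` D c).
    apply/seteqP; split=> [w [bs b't] c _|w Dw].
      by split=> ->.
    by split; [apply: (Dw b I).1|apply: (Dw b' I).2].
  rewrite DE.
  pose sys (i : 'I_n + 'I_B) := match i with
    | inl a => generated_events measurable (Z a)
    | inr b => generated_events setT (J b)
    end.
  have indep' : mutually_independent P sys by [].
  apply: joint_independent.
  - by rewrite -DE; apply: measurableI; exact: mJ.
  - move=> A' mA'.
    apply: (mutually_independent_blocks (sigma := inl) (tau := inr) indep') => //.
    + by move=> ? ? [].
    + by move=> ? ? [].
    + by move=> i; exists (A' i) => //; rewrite setTI.
    + by move=> c; exists (D c) => //; rewrite setTI.
  - by rewrite -[X in measurable X]setTI; exact: mphi'.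
have Paa b b' s t : b != b' -> fine (P (a b s `&` a b' t)) =
    #|{ffun 'I_k -> 'I_n}|%:R^-1 * #|{ffun 'I_k -> 'I_n}|%:R^-1.
  move=> bb'.
  (* Two distinct draws are treated as two blocks of size one. *)
  have := @mutually_independent_blocks _ _ _ _ _ _ unit unit (fun=> inr b)
    (fun=> inr b') (fun=> a b s) (fun=> a b' t) indep.
  rewrite !bigcap_const; try by exists tt.
  move=> ->.
  - by rewrite [P (a b s)]PJ [P (a b' t)]PJ cardK.
  - by move=> [] [].
  - by move=> [] [].
  - by move=> _ _; apply: contraNneq bb' => -[->].
  - by move=> _; exists [set s] => //; rewrite setTI.
  - by move=> _; exists [set t] => //; rewrite setTI.
rewrite quad_form_var_mx//.
(* Summing over all tuples with indicators separates the randomness of the draws from that of the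
   data. *)
have VE w : lincomb v (V_stat (kernel_h g f) Z J w) =
    B%:R^-1 * \sum_b \sum_s (\1_(a b s) w * x s w).
  rewrite lincombZ lincomb_sum; congr (_ * _); apply: eq_bigr => b _.
  rewrite (bigD1 (J b w))//= big1 => [|s sJ].
    rewrite indicE aE eqxx mul1r addr0 /x /kernel_lin.
    congr (lincomb v (kernel_h g f _)).
    by apply/funext => j; rewrite tnth_mktuple.
  by rewrite indicE aE eq_sym (negbTE sJ) mul0r.
apply: le_trans (resample_variance_le (a := a) (x := x) (C := C) (bad := bad)
  B0 _ _ _ _ _ _ _ _ _ _ VE) _ => //.
- by rewrite cardK expn_gt0 n0.
- by move=> b s; rewrite [P _]PJ cardK.
- move=> b s t st; apply/seteqP; split=> // w [Js Jt].
  by move: st; rewrite -(Js : J b w = s) -(Jt : J b w = t) eqxx.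
- by move=> s; exact: x2.
- move=> b s; have := pair_indep b b s s _ (mphi s) (Lfun1_Lfun2 (x2 s)).
  by rewrite setIid.
- move=> b b' s t.
  apply: (pair_indep b b' s t
    (fun y => kernel_lin g f v s y * kernel_lin g f v t y)).
    exact: measurable_funM.
  exact: Lfun1M (x2 s) (x2 t).
- move=> s t /existsPn st; apply: (kernel_lin_disjoint g_int f_int Z_iid) => //.
  by move=> i j; have /existsPn := st i; apply.
have C0 : 0 <= C.
  apply: le_trans (xC [ffun=> Ordinal n0]).
  by apply: mean_ge0 => w; rewrite -expr2 sqr_ge0.
(* Clearing denominators turns the remaining inequality into the count of meeting pairs. *)
rewrite lerD2l ler_wpM2l ?mulr_ge0// cardK.
rewrite ler_pdivrMr ?exprn_gt0 ?ltr0n ?expn_gt0 ?n0// mulrAC.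
rewrite ler_pdivlMr ?ltr0n// -!natrX -!natrM ler_nat mulnC.
exact: card_meeting_pairs.
Qed.

(** * Passage to the lower limit *)

Lemma square_integrable_lincomb (d : measure_display)
    (Omega : measurableType d) (R : realType) (P : probability Omega R)
    (q : nat) (X : Omega -> 'cV[R]_q) (v : 'cV[R]_q) :
  square_integrable P X -> (fun w => lincomb v (X w)) \in Lfun P 2%:E.
Proof.
move=> X2; apply: Lfun2_sum => i.
rewrite (_ : (fun w => _) = v i ord0 \o* (fun w => X w i ord0)).
  by apply: Lfun_scale => //; rewrite ler1n.
by apply/funext => w /=; rewrite mulrC.
Qed.

(** An eventual lower bound [- e] passes to the tail infima and then to their limit; [e] is
    arbitrary. *)
Lemma limn_einf_ge0 (R : realType) (u : nat -> R) :
  (forall e, 0 < e -> \forall n \near \oo, - e <= u n) ->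
  (0 <= limn_einf (EFin \o u))%E.
Proof.
move=> u_ge; apply/lee_addgt0Pr => e e0; rewrite -leeBlDr// sub0e.
rewrite limn_einf_lim; apply: lime_ge; first exact: is_cvg_einfs.
have [N _ uN] := u_ge e e0.
exists N => // n /= Nn; apply: le_ereal_inf_tmp => _ [m /= nm <-].
by rewrite lee_fin; apply: uN => /=; exact: leq_trans Nn nm.
Qed.

Theorem theorem2 (R : realType) (d d' : measure_display)
  (Omega : measurableType d) (T : measurableType d')
  (P : probability Omega R) (F : probability T R)
  (q : nat) (g : T -> 'M[R]_q) (f : T -> 'cV[R]_q)
  (Z Z' : nat -> {RV P >-> T})
  (k B : nat -> nat)
  (J : forall n : nat, 'I_(B n) -> Omega -> {ffun 'I_(k n) -> 'I_n})
  (* standing assumptions on g and f *)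
  (g_inv : forall z, g z \in unitmx)
  (g_int : integrable_mx F g)
  (f_int : integrable_mx F f)
  (Eg_inv : mean_mx F g \in unitmx)
  (* the data, the independent copies and the resampling indices *)
  (Z_iid : iid_pair F Z Z')
  (J_unif : forall n : nat, (0 < n)%N -> uniform_resampling Z (J n))
  (* inverses exist almost surely, repeated data points allowed *)
  (sum_g_inv : forall (m : nat) (t : 'I_m -> nat), (0 < m)%N ->
    {ae P, forall w, sum_g g (fun j => Z (t j) w) \in unitmx})
  (* variances and covariances are finite *)
  (tilde_L2 : forall n : nat, (0 < n)%N ->
    square_integrable P (theta_tilde g f Z n))
  (V_L2 : forall n : nat, (0 < n)%N ->
    square_integrable P (V_stat (kernel_h g f) Z (J n)))
  (h_L2 : forall m : nat, (0 < m)%N ->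
    square_integrable P (fun w => kernel_h g f (fun i : 'I_m => Z i w)))
  (h_shared_L2 : forall c m : nat, (0 < c <= m)%N ->
    square_integrable P
      (fun w => kernel_h g f (shared_sample (k := m) Z Z' c w)))
  (* sample sizes: k n <= n also at n = 0, so that no index type is empty *)
  (k_le : forall n : nat, (k n <= n)%N)
  (k_gt0 : forall n : nat, (0 < n)%N -> (0 < k n)%N)
  (B_gt0 : forall n : nat, (0 < n)%N -> (0 < B n)%N)
  (k_incr : {homo k : m n / (m <= n)%N})
  (k_oo : k n @[n --> \oo] --> \oo)
  (h_H : class_H P Z (kernel_h g f))
  (k_small : (fun n : nat => (k n)%:R : R^o) =o_\oo
               (fun n : nat => n%:R `^ 4^-1 : R^o))
  (zeta_lim : exists2 L : 'M[R]_q, positive_definite L &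
    (k n)%:R ^+ 2 *: zeta P (kernel_h g f) Z Z' 1 (k n) @[n --> \oo] --> L)
  (nBk : (n%:R / ((B n)%:R * (k n)%:R) : R) @[n --> \oo] --> (0 : R)) :
  forall v : 'cV[R]_q,
    (0 <= limn_einf (fun n : nat =>
       (quad_form (var_mx P (theta_tilde g f Z n)
                   - var_mx P (V_stat (kernel_h g f) Z (J n))) v)%:E))%E.
Proof.
move=> v; apply: limn_einf_ge0 => e e0.
have [M HM] := h_H.
pose C := \sum_i \sum_j `|v i ord0| * `|v j ord0| * M.
(* Once [1/B] and [k^2/n] are at most [c], the variance bound is at most [3 |C| c <= e]; the added 1
   keeps the denominator positive. *)
pose c := e / (4 * (`|C| + 1)).
have C1 : 0 < `|C| + 1 by rewrite ltr_wpDl.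
have c0 : 0 < c by rewrite divr_gt0// mulr_gt0.
have min0 : 0 < Num.min 1 c by rewrite lt_min ltr01.
move/eqoP : k_small => /(_ _ min0) k_small'.
move/cvgrPdist_le : nBk => /(_ _ c0) nBk'.
near=> n.
have n0 : (0 < n)%N by near: n; exists 1%N.
have n0R : 0 < n%:R :> R by rewrite ltr0n.
have kn0 : 0 < (k n)%:R :> R by rewrite ltr0n k_gt0.
have Bn0 : 0 < (B n)%:R :> R by rewrite ltr0n B_gt0.
(* Since [k <= n], [1/B] is at most [n/(Bk)]. *)
have Bc : (B n)%:R^-1 <= c.
  have : `|0 - n%:R / ((B n)%:R * (k n)%:R)| <= c by near: n.
  rewrite sub0r normrN ger0_norm ?divr_ge0 ?mulr_ge0//; apply: le_trans.
  rewrite ler_pdivlMr ?mulr_gt0// mulKf ?gt_eqF// ler_nat.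
  exact: k_le.
have kc : (k n)%:R ^+ 2 / n%:R <= c.
  have : `|(k n)%:R : R| <= Num.min 1 c * `|n%:R `^ 4^-1 : R| by near: n.
  rewrite normr_nat ger0_norm ?powR_ge0// => kn.
  set p := n%:R `^ 4^-1 in kn.
  have p4 : p ^+ 4 = n%:R.
    by rewrite -powR_mulrn ?powR_ge0// -powRrM mulVf ?powRr1// pnatr_eq0.
  have p1 : 1 <= p ^+ 2.
    have : 1 <= p ^+ 4 by rewrite p4 ler1n.
    by rewrite -[4%N]/(2 * 2)%N exprM; have := sqr_ge0 p; nra.
  have mc : Num.min 1 c <= c by rewrite ge_min lexx orbT.
  have m1 : Num.min 1 c <= 1 by rewrite ge_min lexx.
  rewrite ler_pdivrMr// -p4.
  apply: (@le_trans _ _ ((Num.min 1 c * p) ^+ 2)).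
    by rewrite ler_sqr ?nnegrE ?mulr_ge0 ?powR_ge0// ltW.
  (* With [m = min 1 c], write [m^2 p^2] as [m] times [m p^2]: the first factor is at most [c], the
     second at most [p^4] because [m <= 1 <= p^2]. *)
  rewrite exprMn -[4%N]/(2 * 2)%N [p ^+ (2 * 2)]exprM expr2 -mulrA.
  by apply: ler_pM; rewrite ?mulr_ge0 ?sqr_ge0 ?(ltW min0)//; nra.
rewrite quad_formB (quad_form_var_mx _ (tilde_L2 n n0)).
have := V_stat_variance_le g_int f_int Z_iid (J_unif n n0) n0 (k_gt0 n n0)
  (B_gt0 n n0) (fun t => HM _ t (k_gt0 n n0)) (V_L2 n n0) (erefl C).
(* Only nonnegativity of the variance of the full-sample estimator enters the lower bound. *)
have := mean_sqr_le (square_integrable_lincomb v (tilde_L2 n n0)).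
set Vt := mean P _; set Vh := quad_form _ _ => tilde_ge0 Vle.
have CC : C <= `|C| by exact: ler_norm.
have C0 : 0 <= `|C| by [].
have ce : (4 * (`|C| + 1)) * c = e by rewrite /c mulrC divfK// gt_eqF// mulr_gt0.
have CB : C / (B n)%:R <= `|C| * c.
  apply: (le_trans (ler_norm _)).
  by rewrite normrM ler_wpM2l// ger0_norm// invr_ge0.
have Ck : 2 * C * ((k n)%:R ^+ 2 / n%:R) <= 2 * (`|C| * c).
  rewrite -mulrA ler_wpM2l//; apply: (le_trans (ler_norm _)).
  by rewrite normrM ler_wpM2l// ger0_norm// divr_ge0// sqr_ge0.
nra.
Unshelve. all: by end_near. Qed.
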